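(* Let $k\in\mathbb{Z}$ and $i,j,n\in\mathbb{Z}^+$. Then $\chi_{n,k}(K_{i,j})$ exists if and only if $\gcd(ij-1,n)\mid(j-1)k$, and in that case $\chi_{n,k}(K_{i,j})=2$. Moreover, the condition $\gcd(ij-1,n)\mid(j-1)k$ is equivalent to $\gcd(ij-1,n)\mid(i-1)k$.
   Context: $K_{i,j}$ is the complete bipartite graph with parts of sizes $i$ and $j$. For a graph $G=(V,E)$, a labeling $\ell:V\to\mathbb{Z}$ is proper if adjacent vertices get distinct labels, its order is the size of its image, and it is a closed coloring with remainder $k\bmod n$ if $\sum_{w\in N[v]}\ell(w)\equiv k\pmod n$ for every $v$, where $N[v]$ is the closed neighborhood of $v$. $\chi_{n,k}(G)$ exists iff a proper closed coloring with remainder $k\bmod n$ exists, and then is the minimum order of such a coloring. *)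

(* Defs.v *)
From HB Require Import structures.
From mathcomp Require Import all_boot all_order all_algebra.

Set Implicit Arguments.
Unset Strict Implicit.
Unset Printing Implicit Defensive.

Import Order.TTheory GRing.Theory Num.Theory.

Local Open Scope ring_scope.

Record sgraph := SGraph {
  vertex :> finType;
  adj : rel vertex;
  adj_sym : symmetric adj;
  adj_irrefl : irreflexive adj }.

Definition closed_nbhd (G : sgraph) (v : G) : {set G} :=
  [set w | (w == v) || adj v w].

Definition proper_labeling (G : sgraph) (l : G -> int) : Prop :=
  forall u v : G, adj u v -> l u <> l v.

Definition labeling_order (G : sgraph) (l : G -> int) : nat :=
  size (undup (codom l)).

Definition closed_coloring (G : sgraph) (n : nat) (k : int) (l : G -> int)
    : Prop :=
  forall v : G, (\sum_(w in closed_nbhd v) l w = k %[mod n%:Z])%Z.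

Definition proper_closed_coloring (G : sgraph) (n : nat) (k : int)
    (l : G -> int) : Prop :=
  proper_labeling l /\ closed_coloring n k l.

(* The number chi_(n,k)(G) is partial, so it is given by two predicates: when  *)
(* it exists, and when its value is m.                                        *)
Definition chi_exists (G : sgraph) (n : nat) (k : int) : Prop :=
  exists l : G -> int, proper_closed_coloring n k l.

Definition chi_is (G : sgraph) (n : nat) (k : int) (m : nat) : Prop :=
  (exists l : G -> int, proper_closed_coloring n k l /\ labeling_order l = m) /\
  (forall l : G -> int, proper_closed_coloring n k l ->
     (m <= labeling_order l)%N).

Definition Kbip_adj (i j : nat) (u v : 'I_i + 'I_j) : bool :=
  match u, v with
  | inl _, inr _ | inr _, inl _ => true
  | _, _ => false
  end.

Lemma Kbip_adj_sym (i j : nat) : symmetric (@Kbip_adj i j).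
Proof. by move=> [u|u] [v|v]. Qed.

Lemma Kbip_adj_irrefl (i j : nat) : irreflexive (@Kbip_adj i j).
Proof. by move=> [u|u]. Qed.

Definition Kbip (i j : nat) : sgraph :=
  SGraph (@Kbip_adj_sym i j) (@Kbip_adj_irrefl i j).

(* Main.v *)
Require Import Defs.
From mathcomp Require Import all_boot all_order all_algebra.
From mathcomp Require Import ring.

Set Implicit Arguments.
Unset Strict Implicit.
Unset Printing Implicit Defensive.

Import Order.TTheory GRing.Theory Num.Theory.

Local Open Scope ring_scope.

(* If A and B are the label sums of the two parts, every left label is
   congruent to a = k - B and every right label to b = k - A; so only the two
   residues a and b matter, subject to a + j b = k = b + i a mod n. Eliminating
   b leaves (i j - 1) a = (j - 1) k mod n, a linear congruence that is solvable
   exactly under the gcd condition. Distinctness of the two labels comes for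
   free, as b may be shifted by n. *)

Lemma sum_closed_nbhd_inl (i j : nat) (l : Kbip i j -> int) (u : 'I_i) :
  \sum_(w in closed_nbhd (inl u : Kbip i j)) l w =
  l (inl u) + \sum_(v < j) l (inr v).
Proof.
rewrite big_sumType /=; congr (_ + _).
  by rewrite (big_pred1 u) // => x; rewrite inE /= orbF.
by apply: eq_bigl => x; rewrite inE.
Qed.

Lemma sum_closed_nbhd_inr (i j : nat) (l : Kbip i j -> int) (v : 'I_j) :
  \sum_(w in closed_nbhd (inr v : Kbip i j)) l w =
  l (inr v) + \sum_(u < i) l (inl u).
Proof.
rewrite big_sumType /= addrC; congr (_ + _).
  by rewrite (big_pred1 v) // => x; rewrite inE /= orbF.
by apply: eq_bigl => x; rewrite inE.
Qed.

(** Divisibility replaces congruence here so that later steps reduce to linear combinations of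
    multiples of [n]. *)
Lemma closed_coloring_KbipP (i j n : nat) (k : int) (l : Kbip i j -> int) :
  closed_coloring n k l <->
  (forall u, (n %| l (inl u) + \sum_(v < j) l (inr v) - k)%Z) /\
  (forall v, (n %| l (inr v) + \sum_(u < i) l (inl u) - k)%Z).
Proof.
split=> [cl | [cl cr] [u | v]].
- split=> [u | v].
    by rewrite -sum_closed_nbhd_inl -eqz_mod_dvd; apply/eqP/cl.
  by rewrite -sum_closed_nbhd_inr -eqz_mod_dvd; apply/eqP/cl.
- by rewrite sum_closed_nbhd_inl; apply/eqP; rewrite eqz_mod_dvd.
- by rewrite sum_closed_nbhd_inr; apply/eqP; rewrite eqz_mod_dvd.
Qed.

Lemma dvdz_sum_shift (m : nat) (d c : int) (f : 'I_m -> int) :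
  (forall u, (d %| f u + c)%Z) -> (d %| \sum_u f u + m%:Z * c)%Z.
Proof.
move=> df; have -> : \sum_u f u + m%:Z * c = \sum_u (f u + c).
  by rewrite big_split /= sumr_const card_ord -mulr_natl natz.
by apply: rpred_sum => u _; apply: df.
Qed.

(** Adding up the conditions over each part leaves two relations between the label sums [A] and [B],
    so the argument covers labelings with any number of values. *)
Lemma closed_coloring_Kbip_dvdz (i j n : nat) (k : int) (l : Kbip i j -> int) :
  closed_coloring n k l ->
  (gcdz (i%:Z * j%:Z - 1) n%:Z %| (j%:Z - 1) * k)%Z.
Proof.
case/closed_coloring_KbipP => cl cr.
set A := \sum_(u < i) l (inl u) in cr; set B := \sum_(v < j) l (inr v) in cl.
have dA : (n %| A + i%:Z * (B - k))%Z.
  by apply: dvdz_sum_shift => u; rewrite addrA.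
have dB : (n %| B + j%:Z * (A - k))%Z.
  by apply: dvdz_sum_shift => v; rewrite addrA.
(* Subtracting the second relation from [j] times the first cancels [A]; what is left differs from
   [(j - 1) * k] by a multiple of [i * j - 1]. *)
have -> : (j%:Z - 1) * k =
    j%:Z * (A + i%:Z * (B - k)) - (B + j%:Z * (A - k))
    - (B - k) * (i%:Z * j%:Z - 1) by ring.
apply: rpredB; last by rewrite dvdz_mull ?dvdz_gcdl.
by apply: dvdz_trans (dvdz_gcdr _ _) _; apply: rpredB => //; apply: dvdz_mull.
Qed.

Definition bilabeling (i j : nat) (a b : int) (w : Kbip i j) : int :=
  if w is inl _ then a else b.

Lemma bilabeling_proper (i j : nat) (a b : int) :
  a <> b -> proper_labeling (@bilabeling i j a b).
Proof. by move=> ab [u | u] [v | v] //= _; apply: nesym. Qed.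

Lemma bilabeling_closed (i j n : nat) (k a b : int) :
  (n %| a + j%:Z * b - k)%Z -> (n %| b + i%:Z * a - k)%Z ->
  closed_coloring n k (@bilabeling i j a b).
Proof.
move=> da db; apply/closed_coloring_KbipP.
by split=> ? /=; rewrite sumr_const card_ord -mulr_natl natz.
Qed.

Lemma bilabeling_order (i j : nat) (a b : int) :
  (0 < i)%N -> (0 < j)%N -> a <> b ->
  labeling_order (@bilabeling i j a b) = 2%N.
Proof.
move=> hi hj /eqP ab; apply: (@perm_size _ _ [:: a; b]).
apply: uniq_perm; rewrite ?undup_uniq //= ?inE ?ab // => x.
rewrite mem_undup !inE; apply/codomP/orP.
  by case=> [[u | v] ->]; [left | right].
case=> /eqP->; first by exists (inl (Ordinal hi)).
by exists (inr (Ordinal hj)).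
Qed.

Lemma proper_Kbip_order_ge2 (i j : nat) (l : Kbip i j -> int) :
  (0 < i)%N -> (0 < j)%N -> proper_labeling l -> (2 <= labeling_order l)%N.
Proof.
move=> hi hj pl; pose x : Kbip i j := inl (Ordinal hi).
pose y : Kbip i j := inr (Ordinal hj).
have /eqP lxy : l x <> l y by apply: pl.
apply: (@uniq_leq_size _ [:: l x; l y]); first by rewrite /= inE lxy.
by move=> z; rewrite mem_undup !inE => /orP[] /eqP->; apply: codom_f.
Qed.

Lemma exists_bilabeling (i j n : nat) (k : int) :
  (0 < n)%N -> (gcdz (i%:Z * j%:Z - 1) n%:Z %| (j%:Z - 1) * k)%Z ->
  exists a b : int, a <> b /\
    proper_closed_coloring n k (@bilabeling i j a b).
Proof.
move=> hn /dvdzP[q Eq].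
have [u [v Euv]] := Bezoutz (i%:Z * j%:Z - 1) n%:Z.
(* Bezout gives [u * (i * j - 1) + v * n = gcd]; scaling by [q] turns the right side into
   [(j - 1) * k], so [a] solves the congruence modulo [n]. *)
pose a := q * u.
(* The right label is [k - i * a], shifted by [n] only if it coincides with [a]; the shift separates
   them because [n] is positive. *)
have [e ae] : exists e : int, a <> k - i%:Z * a + e * n%:Z.
  have [ab | ab] := eqVneq a (k - i%:Z * a); last first.
    by exists 0; rewrite mul0r addr0; apply/eqP.
  exists 1; rewrite mul1r -ab => /eqP.
  by rewrite -subr_eq0 opprD addNKr oppr_eq0 eqz_nat eqn0Ngt hn.
exists a, (k - i%:Z * a + e * n%:Z); split=> //; split.
  exact: bilabeling_proper.
have Ea : (i%:Z * j%:Z - 1) * a = (j%:Z - 1) * k - q * v * n%:Z.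
  by rewrite Eq -Euv /a; ring.
apply: bilabeling_closed; last first.
  by apply/dvdzP; exists e; ring.
(* The quotient collects [q * v] from the Bezout relation and [j * e] from the shift, which is
   counted once per right vertex. *)
apply/dvdzP; exists (q * v + j%:Z * e).
have -> : a + j%:Z * (k - i%:Z * a + e * n%:Z) - k =
    (j%:Z - 1) * k - (i%:Z * j%:Z - 1) * a + j%:Z * e * n%:Z by ring.
by rewrite Ea; ring.
Qed.

(** Modulo [d], [x] and [y] are mutually inverse, so multiplying [y - 1] by [-x] gives [x - 1]. *)
Lemma dvdz_pred_mul_swap (d x y k : int) :
  (d %| x * y - 1)%Z -> (d %| (y - 1) * k)%Z -> (d %| (x - 1) * k)%Z.
Proof.
move=> dxy dy.
have -> : (x - 1) * k = k * (x * y - 1) - x * ((y - 1) * k) by ring.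
by apply: rpredB; apply: dvdz_mull.
Qed.

Theorem theorem4p3 (k : int) (i j n : nat)
    (hi : (0 < i)%N) (hj : (0 < j)%N) (hn : (0 < n)%N) :
  (chi_exists (Kbip i j) n k <->
     (gcdz (i%:Z * j%:Z - 1) n%:Z %| (j%:Z - 1) * k)%Z) /\
  (chi_exists (Kbip i j) n k -> chi_is (Kbip i j) n k 2) /\
  ((gcdz (i%:Z * j%:Z - 1) n%:Z %| (j%:Z - 1) * k)%Z <->
     (gcdz (i%:Z * j%:Z - 1) n%:Z %| (i%:Z - 1) * k)%Z).
Proof.
have ex_dvd : chi_exists (Kbip i j) n k ->
    (gcdz (i%:Z * j%:Z - 1) n%:Z %| (j%:Z - 1) * k)%Z.
  by case=> l [_ /closed_coloring_Kbip_dvdz].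
split; [|split].
- split=> // /(exists_bilabeling hn)[a [b [_ pc]]].
  by exists (bilabeling a b).
- move=> /ex_dvd /(exists_bilabeling hn)[a [b [ab pc]]]; split.
    by exists (bilabeling a b); split=> //; apply: bilabeling_order.
  by move=> l [pl _]; apply: proper_Kbip_order_ge2.
- split; apply: dvdz_pred_mul_swap; first exact: dvdz_gcdl.
  by rewrite [j%:Z * _]mulrC dvdz_gcdl.
Qed.
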